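(* There is an absolute constant $C$ such that the following holds. Let $q$ be an even power of an odd prime. Then the graph $U_q$ has an independent set $I$ containing no absolute points with \[ |I| \geq 0.19239\, q^{5/4} - Cq. \]
   Context: For $q$ a square of a prime power, the vertices of $U_q$ are the points of $PG(2,q)$, i.e. nonzero vectors $(x_0,x_1,x_2)\in\mathbb{F}_q^3$ up to nonzero scalar multiples. Two distinct vertices $(x_0,x_1,x_2)$ and $(y_0,y_1,y_2)$ are adjacent iff $x_0y_0^{\sqrt q}+x_1y_1^{\sqrt q}+x_2y_2^{\sqrt q}=0$. A vertex $(x_0,x_1,x_2)$ is an absolute point if $x_0^{\sqrt q+1}+x_1^{\sqrt q+1}+x_2^{\sqrt q+1}=0$. *)

(* Defs.v *)
From mathcomp Require Import all_boot all_order all_algebra all_field.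
From Stdlib Require Import Reals.
Set Implicit Arguments. Unset Strict Implicit. Unset Printing Implicit Defensive.
Import GRing.Theory.
Local Open Scope ring_scope.

Section PG.
Variable F : finFieldType.

Definition pg_class (v : 'rV[F]_3) : {set 'rV[F]_3} :=
  [set c *: v | c in [set c : F | c != 0]].

Definition PG2 : {set {set 'rV[F]_3}} :=
  [set pg_class v | v in [set v : 'rV[F]_3 | v != 0]].

(* Hermitian-type form x0 y0^r + x1 y1^r + x2 y2^r, with r = sqrt q. *)
Definition herm (r : nat) (x y : 'rV[F]_3) : F :=
  \sum_(i < 3) x 0 i * (y 0 i) ^+ r.

Definition Uq_adj (r : nat) (P Q : {set 'rV[F]_3}) : Prop :=
  P != Q /\ exists x y, [/\ x \in P, y \in Q & herm r x y = 0].

Definition Uq_absolute (r : nat) (P : {set 'rV[F]_3}) : Prop :=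
  exists x, x \in P /\ \sum_(i < 3) (x 0 i) ^+ r.+1 = 0.

Definition Uq_independent (r : nat) (I : {set {set 'rV[F]_3}}) : Prop :=
  I \subset PG2 /\ forall P Q, P \in I -> Q \in I -> ~ Uq_adj r P Q.
End PG.

(* Main.v *)
(** Put [r = sqrt q].  In a suitable basis containing a hyperbolic pair the
    Hermitian form of the points [(1, b, s)] and [(1, b', s')] is
    [2 (b + b'^r) + s s'^r].  Take [s] in the subfield of order [r] and
    [b = (t + eps u) / 2] with [t], [u] in that subfield and [eps^r = - eps]: the form
    can vanish only if [t + t' + s s' = 0], whatever [u] is.  It remains to find
    about [r^(3/2)] pairs [(s, t)] for which this never happens.

    Write the elements of the subfield as polynomials of degree less than [m]
    over [F_p], in a generator [theta] of its units.  If [m = 2 k + 1], let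
    [s] have degree at most [k] with top coefficient [j] in [[-a, a]], and let
    the coefficient [i] of [t] at [theta^(2 k)] lie in an interval such that
    the integer [i + i' + j j'] is always strictly between [0] and [p].  With
    [a] close to [sqrt (p / 6)] this leaves at least [p^(3/2) / sqrt 27]
    pairs [(i, j)].  If [m = 2 k], [s] of degree less than [k] suffices, as
    [s s'] then does not reach [theta^(2 k - 1)].  In both cases [C = 0] works. *)

Require Import Defs.
From mathcomp Require Import all_boot all_order all_algebra all_field.
From mathcomp Require Import all_solvable.
From mathcomp Require Import zify ring.

Set Implicit Arguments.
Unset Strict Implicit.
Unset Printing Implicit Defensive.

(** * Polynomials over the prime field as coordinates on a subfield *)

Section PolynomialCoordinates.
Import GRing.Theory.
Local Open Scope ring_scope.

Lemma finField_prim_root (F : finFieldType) :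
  exists z : F, (#|F|.-1).-primitive_root z.
Proof.
have F_gt1 := finNzRing_gt1 F.
have n_gt0 : (0 < #|F|.-1)%N by rewrite -ltnS prednK // ltnW.
have sz : size (enum (predC1 (0 : F))) = #|F|.-1 by rewrite -cardE cardC1.
have /hasP[z _ prim_z] : has (#|F|.-1).-primitive_root (enum (predC1 (0 : F))).
  apply: has_prim_root; rewrite ?enum_uniq ?sz //.
  apply/allP => x; rewrite mem_enum inE /= => x_neq0.
  rewrite unity_rootE; apply/eqP/(mulfI x_neq0).
  by rewrite -exprS prednK ?expf_card ?mulr1 // ltnW.
by exists z.
Qed.

Variables (p m : nat) (F : finFieldType) (iota : {rmorphism 'F_p -> F}).
Hypotheses (p_pr : prime p) (p_odd : odd p) (m_gt0 : (0 < m)%N).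

Definition eval_at (theta : F) (g : {poly 'F_p}) : F :=
  (map_poly iota g).[theta].

Lemma eval_atD theta g h :
  eval_at theta (g + h) = eval_at theta g + eval_at theta h.
Proof. by rewrite /eval_at rmorphD hornerD. Qed.

Lemma eval_atM theta g h :
  eval_at theta (g * h) = eval_at theta g * eval_at theta h.
Proof. by rewrite /eval_at rmorphM hornerM. Qed.

(* If [g] vanished at [theta], reduction modulo [g] would squeeze all the
   [p ^ m - 1] powers of [theta] into the [p ^ (m - 1)] values of the
   polynomials of size at most [m - 1]. *)
Lemma eval_at_eq0 theta (g : {poly 'F_p}) :
  ((p ^ m).-1).-primitive_root theta -> (size g <= m)%N ->
  eval_at theta g = 0 -> g = 0.
Proof.
move=> prim_th sz_g g_th0; apply/eqP/negPn/negP => g_neq0.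
pose e (v : 'rV['F_p]_(m.-1)) := eval_at theta (rVpoly v).
pose f (i : 'I_((p ^ m).-1)) := theta ^+ i.
have f_inj : injective f.
  move=> i j /eqP; rewrite (eq_prim_root_expr prim_th) !modn_small //.
  by move/eqP/val_inj.
have f_e : {subset codom f <= codom e}.
  move=> _ /codomP[i ->]; apply/codomP; exists (poly_rV (modp 'X^i g)).
  have sz_mod : (size (modp 'X^i g) <= m.-1)%N.
    by rewrite -ltnS prednK // (leq_trans _ sz_g) // ltn_modp.
  have -> : f i = eval_at theta 'X^i by rewrite /eval_at map_polyXn hornerXn.
  rewrite /e poly_rV_K // {1}(divp_eq 'X^i g) eval_atD eval_atM g_th0.
  by rewrite mulr0 add0r.
have := leq_trans (subset_leq_card (introT subsetP f_e)) (leq_image_card _ _).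
rewrite card_codom // card_ord cardT -cardE card_mx mul1n card_Fp //.
rewrite -{1}(prednK m_gt0) expnS.
(* With [N = p ^ (m - 1)] the count reads [p * N - 1 <= N], impossible for [p > 2]. *)
have p_gt2 : (2 < p)%N by rewrite odd_prime_gt2.
have : (0 < p ^ m.-1)%N by rewrite expn_gt0 prime_gt0.
by nia.
Qed.

Lemma eval_at_inj theta (g h : {poly 'F_p}) :
  ((p ^ m).-1).-primitive_root theta ->
  (size g <= m)%N -> (size h <= m)%N ->
  eval_at theta g = eval_at theta h -> g = h.
Proof.
move=> prim_th sz_g sz_h eq_gh; apply/eqP; rewrite -subr_eq0; apply/eqP.
apply: (eval_at_eq0 prim_th); last first.
  by rewrite /eval_at rmorphB hornerD hornerN -!/(eval_at _ _) eq_gh subrr.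
by rewrite (leq_trans (size_polyD _ _)) // size_polyN geq_max sz_g.
Qed.

Lemma Fp_expX (c : 'F_p) n : c ^+ (p ^ n) = c.
Proof.
elim: n => [|n IHn]; first by rewrite expn0 expr1.
have cp : c ^+ p = c by have := expf_card c; rewrite card_Fp.
by rewrite expnS exprM cp.
Qed.

Lemma eval_at_frob theta g : theta ^+ (p ^ m) = theta ->
  eval_at theta g ^+ (p ^ m) = eval_at theta g.
Proof.
move=> th_fix; have pF : p \in [pchar F].
  by rewrite (rmorph_pchar iota) ?pchar_Fp.
have frobD (x y : F) : (x + y) ^+ (p ^ m) = x ^+ (p ^ m) + y ^+ (p ^ m).
  by rewrite exprDn_pchar // pnatX pnatE ?pF.
elim/poly_ind: g => [|g c IHg].
  by rewrite /eval_at rmorph0 horner0 expr0n gtn_eqF // expn_gt0 prime_gt0.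
have -> : eval_at theta (g * 'X + c%:P) = eval_at theta g * theta + iota c.
  by rewrite eval_atD eval_atM /eval_at map_polyX map_polyC /= hornerX hornerC.
by rewrite frobD exprMn IHg th_fix -rmorphXn Fp_expX.
Qed.

End PolynomialCoordinates.

(** * Projective points and values of the Hermitian form *)

Section HermitianPoints.
Import GRing.Theory.
Local Open Scope ring_scope.
Variable F : finFieldType.

Lemma mem_pg_class (v x : 'rV[F]_3) :
  reflect (exists2 c, c != 0 & x = c *: v) (x \in pg_class v).
Proof.
apply: (iffP imsetP) => [[c] | [c c_neq0 ->]]; last by exists c; rewrite ?inE.
by rewrite inE => c_neq0 ->; exists c.
Qed.

Lemma herm_scale r c d (x y : 'rV[F]_3) :
  herm r (c *: x) (d *: y) = c * d ^+ r * herm r x y.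
Proof.
rewrite /herm big_distrr; apply: eq_bigr => i _.
by rewrite !mxE exprMn /=; ring.
Qed.

Lemma herm_diag r (x : 'rV[F]_3) : \sum_(i < 3) x 0 i ^+ r.+1 = herm r x x.
Proof. by apply: eq_bigr => i _; rewrite exprS. Qed.

(** Rescaling representatives multiplies the form by a nonzero factor, so one pair of
    representatives decides adjacency; the case [x = y] excludes absolute points. *)
Lemma independent_of_herm_neq0 (X : finType) (f : X -> 'rV[F]_3) r :
  (forall x, f x != 0) -> injective (fun x => pg_class (f x)) ->
  (forall x y, herm r (f x) (f y) != 0) ->
  exists I : {set {set 'rV[F]_3}},
    [/\ Uq_independent r I, forall P, P \in I -> ~ Uq_absolute r P
      & #|I| = #|X|].
Proof.
move=> f_neq0 f_inj herm_f.
have no_orth x y u v : u \in pg_class (f x) -> v \in pg_class (f y) ->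
    herm r u v = 0 -> False.
  case/mem_pg_class => c c_neq0 -> /mem_pg_class[d d_neq0 ->].
  rewrite herm_scale => /eqP.
  rewrite !mulf_eq0 expf_eq0 (negPf c_neq0) (negPf d_neq0) andbF.
  by rewrite (negPf (herm_f x y)).
exists [set pg_class (f x) | x in X]; split; last by rewrite card_imset.
- split.
    apply/subsetP => _ /imsetP[x _ ->].
    by apply/imsetP; exists (f x); rewrite ?inE.
  move=> _ _ /imsetP[x _ ->] /imsetP[y _ ->] [_ [u [v [ux vy huv]]]].
  exact: no_orth ux vy huv.
- move=> _ /imsetP[x _ ->] [u [ux]]; rewrite herm_diag.
  exact: (no_orth x x u u).
Qed.

(* The coordinates of [(1, w, 0) + b (1, -w, 0) + s (0, 0, 1)]; for
   [w ^ (r + 1) = -1] the first two vectors span a hyperbolic line. *)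
Definition hyperbolic_point (w b s : F) : 'rV[F]_3 :=
  \row_i [:: 1 + b; w * (1 - b); s]`_i.

(** [w ^+ r.+1 = -1] turns the first two terms into [(1 + b) (1 + b'^r) - (1 - b) (1 - b'^r)], where
    the constants and the products [b b'^r] cancel. *)
Lemma hyperbolic_point_herm r w b s b' s' :
  (forall x y : F, (x + y) ^+ r = x ^+ r + y ^+ r) ->
  (- 1 : F) ^+ r = -1 -> w ^+ r.+1 = -1 ->
  herm r (hyperbolic_point w b s) (hyperbolic_point w b' s') =
    (b + b' ^+ r) *+ 2 + s * s' ^+ r.
Proof.
move=> frobD frobN1 w_norm.
rewrite /herm !big_ord_recl big_ord0 !mxE /= exprMn !frobD expr1n.
rewrite -[- b']mulN1r exprMn frobN1 mulN1r addr0.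
have -> : w * (1 - b) * (w ^+ r * (1 - b' ^+ r)) =
    w ^+ r.+1 * ((1 - b) * (1 - b' ^+ r)) by rewrite exprS; ring.
by rewrite w_norm; ring.
Qed.

Lemma hyperbolic_point_neq0 w b s :
  w != 0 -> 2%:R != 0 :> F -> hyperbolic_point w b s != 0.
Proof.
move=> w_neq0 two_neq0; apply/eqP => /rowP eq0.
have := eq0 0; have := eq0 1; rewrite !mxE /=.
move/eqP; rewrite mulf_eq0 (negPf w_neq0) subr_eq0 => /eqP <- /eqP.
by rewrite (negPf two_neq0).
Qed.

(** For every such point the first coordinate plus [w^-1] times the second is 2, which forces the
    scalar between two representatives to be 1. *)
Lemma hyperbolic_point_class_inj w b s b' s' :
  w != 0 -> 2%:R != 0 :> F ->
  pg_class (hyperbolic_point w b s) = pg_class (hyperbolic_point w b' s') ->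
  b = b' /\ s = s'.
Proof.
move=> w_neq0 two_neq0 eq_cl.
have : hyperbolic_point w b s \in pg_class (hyperbolic_point w b' s').
  by rewrite -eq_cl; apply/mem_pg_class; exists 1; rewrite ?oner_neq0 ?scale1r.
case/mem_pg_class => c _ /rowP eq_v.
have := eq_v 0; have := eq_v 1; have := eq_v (inord 2).
rewrite !mxE /= inordK //= mulrCA => eq_s /(mulfI w_neq0) eqB eqD.
have c1 : c = 1.
  apply: (mulfI two_neq0).
  have -> : 2%:R * c = c * (1 + b') + c * (1 - b') by ring.
  by rewrite -eqB -eqD; ring.
rewrite c1 !mul1r in eq_s eqD.
by split=> //; apply: (addrI 1).
Qed.

End HermitianPoints.

(** * From families of polynomials to independent sets *)

Section Parametrisation.
Import GRing.Theory.
Local Open Scope ring_scope.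
Variables (p m : nat) (F : finFieldType).
Hypotheses (p_pr : prime p) (p_odd : odd p) (m_gt0 : (0 < m)%N).
Hypothesis card_F : #|F| = (p ^ (2 * m))%N.

(* With [z] a primitive element, [z ^ (r + 1)] generates the units of the
   subfield of order [r], while [z ^ ((r - 1) / 2)] and [z ^ ((r + 1) / 2)]
   are the required [w] and [eps], both because [z ^ ((r ^ 2 - 1) / 2) = -1]. *)
Lemma quadratic_extension_elements : exists theta w eps : F,
  [/\ ((p ^ m).-1).-primitive_root theta, w ^+ (p ^ m).+1 = -1,
      eps != 0 & eps ^+ (p ^ m) = - eps].
Proof.
have [z prim_z] := finField_prim_root F.
set r := (p ^ m)%N.
have r_gt2 : (2 < r)%N.
  rewrite (leq_trans (odd_prime_gt2 p_odd p_pr)) //.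
  by rewrite /r -{1}(expn1 p) leq_exp2l ?prime_gt1.
have r_odd : odd r by rewrite /r oddX p_odd orbT.
have cardE : (#|F|.-1 = r.-1 * r.+1)%N.
  by rewrite card_F mulnC expnM -/r; nia.
rewrite cardE in prim_z.
have [h r_eq] : exists h, r = h.*2.+1.
  by exists r./2; rewrite -[LHS]odd_double_half r_odd.
have h_gt0 : (0 < h)%N by lia.
have half : z ^+ (h * r.+1) = -1.
  have /eqP : (z ^+ (h * r.+1)) ^+ 2 = 1.
    rewrite -exprM -(prim_expr_order prim_z); congr (_ ^+ _); nia.
  rewrite -subr_eq0 subr_sqr_1 mulf_eq0 subr_eq0 addr_eq0 => /orP[|/eqP //].
  rewrite -(prim_order_dvd prim_z) => /dvdn_leq.
  by rewrite muln_gt0 h_gt0 /= => /(_ isT); nia.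
exists (z ^+ r.+1), (z ^+ h), (z ^+ h.+1); split.
- have -> : r.-1 = (r.-1 * r.+1 %/ gcdn r.+1 (r.-1 * r.+1))%N.
    by rewrite gcdnC gcdnC gcdnMl mulnK.
  exact: exp_prim_root.
- by rewrite -exprM.
- rewrite expf_eq0 /=; apply/eqP => z0; move: half.
  rewrite z0 expr0n muln_eq0 gtn_eqF //= => /eqP.
  by rewrite eq_sym oppr_eq0 oner_eq0.
rewrite -exprM; have -> : (h.+1 * r = h.+1 + h * r.+1)%N by nia.
by rewrite exprD half mulrN1.
Qed.

(** [sigma] and [tau] supply [s] and [t]; the factor [p ^ m] counts the free [u], coded by a row of
    [m] coefficients. *)
Lemma independent_of_polynomials (A B : finType)
    (sigma : A -> {poly 'F_p}) (tau : B -> {poly 'F_p}) :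
  injective sigma -> injective tau ->
  (forall a, size (sigma a) <= m)%N -> (forall b, size (tau b) <= m)%N ->
  (forall a a', (size (sigma a * sigma a')%R <= m)%N) ->
  (forall a a' b b', tau b + tau b' + sigma a * sigma a' != 0) ->
  exists I : {set {set 'rV[F]_3}},
    [/\ Uq_independent (p ^ m) I, forall P, P \in I -> ~ Uq_absolute (p ^ m) P
      & #|I| = (#|A| * #|B| * p ^ m)%N].
Proof.
move=> sigma_inj tau_inj sz_sigma sz_tau sz_mul sum_neq0.
have pF : p \in [pchar F] := card_finPcharP card_F p_pr.
pose iota : {rmorphism 'F_p -> F} :=
  (in_alg (pPrimeCharType pF) : {rmorphism 'F_p -> pPrimeCharType pF}).
have [theta [w [eps [prim_th w_norm eps_neq0 eps_conj]]]] :=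
  quadratic_extension_elements.
set r := (p ^ m)%N in prim_th w_norm eps_conj *.
have r_gt0 : (0 < r)%N by rewrite expn_gt0 prime_gt0.
have r_odd : odd r by rewrite /r oddX p_odd orbT.
have frobD (x y : F) : (x + y) ^+ r = x ^+ r + y ^+ r.
  by rewrite exprDn_pchar // pnatX pnatE ?pF.
have frobN1 : (-1 : F) ^+ r = -1 by rewrite -signr_odd r_odd.
have two_neq0 : 2%:R != 0 :> F.
  by rewrite -(dvdn_pcharf pF) gtnNdvd // odd_prime_gt2.
have w_neq0 : w != 0.
  apply/eqP => w0; move: w_norm; rewrite w0 expr0n /= => /eqP.
  by rewrite eq_sym oppr_eq0 oner_eq0.
have th_fix : theta ^+ r = theta.
  by rewrite -(prednK r_gt0) exprS (prim_expr_order prim_th) mulr1.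
pose ev := eval_at iota theta.
have ev_fix g : ev g ^+ r = ev g by apply: eval_at_frob.
have ev_inj (g h : {poly 'F_p}) :
    (size g <= m)%N -> (size h <= m)%N -> ev g = ev h -> g = h.
  exact: (eval_at_inj p_pr p_odd m_gt0 prim_th).
pose bc (t u : F) := (t + eps * u) / 2%:R.
have bc_conj t u : t ^+ r = t -> u ^+ r = u -> bc t u ^+ r = bc t (- u).
  move=> t_fix u_fix.
  have two_fix : (2%:R : F) ^+ r = 2%:R by rewrite frobD expr1n.
  rewrite /bc exprMn frobD exprMn exprVn t_fix u_fix eps_conj two_fix.
  by rewrite mulrN mulNr.
(* Both parts of [bc t u] are recovered by separating the conjugation-invariant
   part from the anti-invariant one. *)
have sep t u : t ^+ r = t -> u ^+ r = u -> t + eps * u = 0 -> t = 0 /\ u = 0.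
  move=> t_fix u_fix tu0.
  have : (t + eps * u) ^+ r = 0 by rewrite tu0 expr0n gtn_eqF.
  rewrite frobD exprMn t_fix u_fix eps_conj => tu0'.
  have t0 : t = 0.
    apply/(mulfI two_neq0); rewrite mulr0.
    have -> : 2%:R * t = (t + eps * u) + (t + - eps * u) by ring.
    by rewrite tu0 tu0' addr0.
  split=> //; move/eqP: tu0.
  by rewrite t0 add0r mulf_eq0 (negPf eps_neq0) => /eqP.
pose f (x : A * B * 'rV['F_p]_m) := hyperbolic_point w
  (bc (ev (tau x.1.2)) (ev (rVpoly x.2))) (ev (sigma x.1.1)).
have [||| I [I_ind I_abs card_I]] := @independent_of_herm_neq0 F _ f r.
- by move=> x; apply: hyperbolic_point_neq0.
- move=> [[a b] v] [[a' b'] v'].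
  case/(hyperbolic_point_class_inj w_neq0 two_neq0) => /= eq_b eq_s.
  have two_inv : (2%:R : F)^-1 != 0 by rewrite invr_eq0.
  have /sep[] : ev (tau b) - ev (tau b')
      + eps * (ev (rVpoly v) - ev (rVpoly v')) = 0.
  + move: (mulIf two_inv eq_b) => /eqP; rewrite -subr_eq0 => /eqP <-; ring.
  + by rewrite frobD -mulN1r exprMn frobN1 !ev_fix.
  + by rewrite frobD -mulN1r exprMn frobN1 !ev_fix.
  move=> /eqP; rewrite subr_eq0 => /eqP /ev_inj eq_t /eqP.
  rewrite subr_eq0 => /eqP /ev_inj eq_u.
  rewrite (sigma_inj _ _ (ev_inj _ _ (sz_sigma a) (sz_sigma a') eq_s)).
  rewrite (tau_inj _ _ (eq_t (sz_tau b) (sz_tau b'))).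
  by rewrite -[v]rVpolyK eq_u ?size_poly // rVpolyK.
- move=> [[a b] v] [[a' b'] v']; rewrite hyperbolic_point_herm //=.
  rewrite bc_conj // ev_fix; apply/eqP => herm0.
  (* The form is a conjugation-invariant part plus [eps] times an invariant element; its vanishing
     kills the first part, whatever [v] and [v'] are. *)
  have /sep[] : ev (tau b) + ev (tau b') + ev (sigma a) * ev (sigma a')
      + eps * (ev (rVpoly v) - ev (rVpoly v')) = 0.
  + by rewrite -herm0 /bc; field.
  + by rewrite !frobD exprMn !ev_fix.
  + by rewrite frobD -mulN1r exprMn frobN1 !ev_fix.
  rewrite /ev -eval_atM -!eval_atD => sum0 _.
  move/eqP: (sum_neq0 a a' b b'); apply.
  apply: (eval_at_eq0 p_pr p_odd m_gt0 prim_th _ sum0).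
  rewrite (leq_trans (size_polyD _ _)) // geq_max sz_mul andbT.
  by rewrite (leq_trans (size_polyD _ _)) // geq_max !sz_tau.
exists I; split=> //.
by rewrite card_I !card_prod card_mx mul1n card_Fp.
Qed.

End Parametrisation.

(** * Polynomials with a separated top coefficient *)

Section ToppedPolynomials.
Import GRing.Theory.
Local Open Scope ring_scope.
Variables (K : fieldType) (n : nat).
Implicit Types (v : 'rV[K]_n) (c : K).

(** Only the coefficient of degree [n] will be constrained; the row [v] of lower ones stays free and
    contributes a power of [p] to the count. *)
Definition topped v c : {poly K} := rVpoly v + c *: 'X^n.

Lemma size_rVpoly v : (size (rVpoly v) <= n)%N.
Proof. exact: size_poly. Qed.

Lemma coef_rVpoly_size v : (rVpoly v)`_n = 0.
Proof. by rewrite nth_default ?size_rVpoly. Qed.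

Lemma coef_topped v c : (topped v c)`_n = c.
Proof. by rewrite coefD coef_rVpoly_size coefZ coefXn eqxx mulr1 add0r. Qed.

Lemma size_topped v c : (size (topped v c) <= n.+1)%N.
Proof.
rewrite (leq_trans (size_polyD _ _)) // geq_max leqW ?size_poly //=.
by rewrite (leq_trans (size_scale_leq _ _)) // size_polyXn.
Qed.

Lemma topped_inj v v' c c' : topped v c = topped v' c' -> v = v' /\ c = c'.
Proof.
move=> eq_t; have eq_c : c = c' by rewrite -(coef_topped v c) eq_t coef_topped.
split=> //; move: eq_t; rewrite eq_c => /addIr eq_v.
by rewrite -[v]rVpolyK eq_v rVpolyK.
Qed.

Lemma topped0 v : topped v 0 = rVpoly v.
Proof. by rewrite /topped scale0r addr0. Qed.

Lemma coef_toppedM v v' c c' : (topped v c * topped v' c')`_(n + n) = c * c'.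
Proof.
have coefM0 : (rVpoly v * rVpoly v')`_(n + n) = 0.
  rewrite nth_default // (leq_trans (size_polyMleq _ _)) //.
  rewrite (leq_trans (leq_pred _)) // leq_add ?size_poly //.
rewrite {1}/topped mulrDl coefD -scalerAl coefZ coefXnM ltnNge leq_addr /=.
rewrite addnK coef_topped /topped mulrDr coefD coefM0 add0r -scalerAr coefZ.
by rewrite coefMXn ltnNge leq_addr /= addnK coef_rVpoly_size mulr0 add0r.
Qed.

Lemma size_toppedM v v' c c' :
  (size (topped v c * topped v' c')%R <= (n + n).+1)%N.
Proof.
rewrite (leq_trans (size_polyMleq _ _)) //.
by have := size_topped v c; have := size_topped v' c'; lia.
Qed.

Lemma size_rVpolyM v v' : (size (rVpoly v * rVpoly v')%R <= (n + n).-1)%N.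
Proof.
rewrite (leq_trans (size_polyMleq _ _)) //.
by have := size_rVpoly v; have := size_rVpoly v'; lia.
Qed.

End ToppedPolynomials.

(** * Choice of the leading coefficients *)

Section LeadingCoefficients.
Import GRing.Theory.
Local Open Scope ring_scope.

Lemma Fp_natr_inj p i j : prime p -> (i < p)%N -> (j < p)%N ->
  i%:R = j%:R :> 'F_p -> i = j.
Proof.
move=> p_pr i_lt j_lt /(congr1 val); rewrite /= !val_Fp_nat //.
by rewrite !modn_small.
Qed.

Lemma Fp_natr_neq0 p i : prime p -> (0 < i < p)%N -> i%:R != 0 :> 'F_p.
Proof.
move=> p_pr /andP[i_gt0 i_lt].
by rewrite -(dvdn_pcharf (pchar_Fp p_pr)) gtnNdvd.
Qed.

(* The integer [i + i' + 2 t0 + (j - a) (j' - a)] lies strictly between [0]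
   and [p], since the last product is at most [a ^ 2] in absolute value. *)
Lemma top_coef_neq0 p a t0 i i' j j' : prime p ->
  (a ^ 2 < 2 * t0)%N -> (j <= 2 * a)%N -> (j' <= 2 * a)%N ->
  (i + i' + 2 * t0 + a ^ 2 < p)%N ->
  (i + t0)%:R + (i' + t0)%:R + (j%:R - a%:R) * (j'%:R - a%:R) != 0 :> 'F_p.
Proof.
move=> p_pr lb j_le j'_le ub.
(* Moving [a * (j + j')] to the left keeps the identity in the natural numbers. *)
have [n n_bd n_eq] : exists2 n, (0 < n < p)%N &
    (n + a * (j + j') = i + i' + 2 * t0 + j * j' + a * a)%N.
  move: (subnKC j_le) (subnKC j'_le).
  set d := (_ - j)%N; set d' := (_ - j')%N => jd jd'.
  (* With [d = 2 a - j] and [d' = 2 a - j'], twice [a ^ 2] plus or minus the product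
     [(j - a) (j' - a)] is [j j' + d d'], respectively [j d' + j' d], hence nonnegative. *)
  have lower : (2 * (j * j') + 4 * (a * a) =
      2 * (a * (j + j')) + (j * j' + d * d'))%N by nia.
  have upper : (2 * (a * (j + j')) =
      2 * (j * j') + (j * d' + j' * d))%N by nia.
  rewrite -mulnn in lb ub.
  by exists (i + i' + 2 * t0 + j * j' + a * a - a * (j + j'))%N; lia.
have -> : (i + t0)%:R + (i' + t0)%:R + (j%:R - a%:R) * (j'%:R - a%:R)
    = n%:R :> 'F_p; last exact: Fp_natr_neq0.
apply: (addIr (a * (j + j'))%:R); rewrite -[RHS]natrD n_eq !natrD !natrM !natrD.
ring.
Qed.

(** The exponent collects [k] lower coefficients of [s], [m - 1] of [t] and all [m] of [u]. In the
    even case [a = 0] leaves only 0 as top coefficient, so [s] has degree less than [k]. *)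
Lemma independent_of_leading_coefs p m (F : finFieldType) k a :
  prime p -> odd p -> (0 < m)%N -> #|F| = (p ^ (2 * m))%N ->
  (a ^ 2 < p./2)%N -> m = (k + k).+1 \/ m = (k + k)%N /\ a = 0%N ->
  exists I : {set {set 'rV[F]_3}},
    [/\ Uq_independent (p ^ m) I, forall P, P \in I -> ~ Uq_absolute (p ^ m) P
      & #|I| = (p ^ (k + m.-1 + m) * ((2 * a).+1 * (p./2 - a ^ 2)))%N].
Proof.
move=> p_pr p_odd m_gt0 card_F a_lt km.
have p_eq : p = (p./2).*2.+1 by rewrite -[LHS]odd_double_half p_odd.
(* The least [t0] with [a ^ 2 < 2 * t0]. Since [2 * t0 <= a ^ 2 + 2], indices [i] below
   [p./2 - a ^ 2] keep the integer of [top_coef_neq0] at most [p - 1]. *)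
pose t0 := (a ^ 2)./2.+1.
pose sigma (x : 'rV['F_p]_k * 'I_(2 * a).+1) :=
  topped x.1 ((x.2 : nat)%:R - a%:R).
pose tau (x : 'rV['F_p]_(m.-1) * 'I_(p./2 - a ^ 2)) :=
  topped x.1 ((x.2 : nat) + t0)%:R.
have a_half := odd_double_half (a ^ 2).
have sigma0 : a = 0%N -> forall x, sigma x = rVpoly x.1.
  move=> a0 [v [j j_lt]]; rewrite /sigma /=.
  have -> : j = 0%N by lia.
  by rewrite a0 subr0 topped0.
have sz_sigma x : (size (sigma x) <= m)%N.
  case: km => [-> | [-> a0]].
    by rewrite (leq_trans (size_topped _ _)) // ltnS leq_addr.
  by rewrite sigma0 // (leq_trans (size_poly _ _)) // leq_addr.
have sz_sigmaM x y : (size (sigma x * sigma y)%R <= m)%N.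
  case: km => [-> | [-> a0]]; first exact: size_toppedM.
  by rewrite !sigma0 // (leq_trans (size_rVpolyM _ _)) // leq_pred.
have coef_sigmaM x y :
    (sigma x * sigma y)`_(m.-1) = (x.2%:R - a%:R) * (y.2%:R - a%:R).
  case: km => [-> | [m_eq a0]]; first exact: coef_toppedM.
  rewrite !sigma0 // nth_default; last by rewrite m_eq size_rVpolyM.
  have -> : x.2 = a :> nat by have := ltn_ord x.2; lia.
  by rewrite subrr mul0r.
have sz_tau x : (size (tau x) <= m)%N.
  by rewrite (leq_trans (size_topped _ _)) // prednK.
(* This is [(a - 1) ^ 2 >= 0]; with [a ^ 2 < p./2] it yields [2 a + 1 <= p], so distinct [j] stay
   distinct modulo [p]. *)
have a_bd : (2 * a <= a ^ 2 + 1)%N by rewrite -mulnn; nia.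
have [|||I [I_ind I_abs card_I]] := @independent_of_polynomials p m F p_pr
  p_odd m_gt0 card_F _ _ sigma tau _ _ sz_sigma sz_tau sz_sigmaM.
- move=> [v [j j_lt]] [v' [j' j'_lt]] /topped_inj[/= -> /addIr].
  move/(Fp_natr_inj p_pr) => eq_j; congr (_, _); apply: val_inj => /=.
  by apply: eq_j; lia.
- move=> [v [i i_lt]] [v' [i' i'_lt]] /topped_inj[/= ->].
  move/(Fp_natr_inj p_pr) => eq_i; congr (_, _); apply: val_inj => /=.
  by apply/(@addIn t0)/eq_i; rewrite /t0; lia.
- move=> x x' y y'; apply/eqP => /(congr1 (fun g : {poly 'F_p} => g`_(m.-1))).
  rewrite 2!coefD !coef_topped coef_sigmaM coef0; apply/eqP.
  case: x.2 x'.2 y.2 y'.2 => [j j_lt] [j' j'_lt] [i i_lt] [i' i'_lt] /=.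
  by apply: top_coef_neq0; rewrite ?/t0 //; lia.
exists I; split=> //.
rewrite card_I !card_prod !card_mx card_Fp // !card_ord !mul1n !expnD.
by ring.
Qed.

End LeadingCoefficients.
From Stdlib Require Import Reals Psatz.

(** * Numerical bounds *)

Section Estimates.

(* For [p < 24] a fixed small [a] works ([p = 3] is the equality case);
   beyond that take [a] the integer part of [sqrt (p / 6)]. *)
Lemma exists_interval_length (p : nat) : odd p -> 2 < p ->
  exists2 a, (expn a 2 < p./2)%N
    & (expn p 3 <= 27 * expn ((2 * a).+1 * (p./2 - expn a 2)) 2)%N.
Proof.
move=> p_odd p_gt2.
have [p_lt | p_ge] := ltnP p 24.
  have [->|p_neq3] := eqVneq p 3; first by exists 0%N.
  exists 1%N.
    by lia.
  by move: p_odd p_gt2 p_lt p_neq3; do 24 (case: p => [|p] //).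
have p_eq : p = (p./2).*2.+1 by rewrite -[LHS]odd_double_half p_odd.
have [a a_le a_gt] : exists2 a, (6 * expn a 2 <= p)%N & (p < 6 * expn a.+1 2)%N.
  have ex0 : exists a, (6 * expn a 2 <= p)%N by exists 0%N.
  have bd a : (6 * expn a 2 <= p)%N -> (a <= p)%N by rewrite -mulnn; nia.
  case: (ex_maxnP ex0 bd) => a a_le a_max; exists a => //.
  by rewrite ltnNge; apply/negP => /a_max; rewrite ltnn.
exists a; first by lia.
move: a_le a_gt; rewrite -!mulnn => a_le a_gt.
have p_le : (5 * p <= 11 * ((2 * a).+1 * (2 * a).+1))%N.
  have a_ge2 : (1 < a)%N by nia.
  by nia.
(* As [a ^ 2 <= p / 6], the difference is at least [p / 3 - 1 / 2], and 16 times this reaches [5 p]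
   from [p = 24] on. *)
have T_ge : (5 * p <= 16 * (p./2 - a * a))%N by lia.
move: (p./2 - _)%N T_ge => T T_ge.
(* With [N] the number of pairs, the product is [125 p^3 <= 11 * 16^2 * N^2], and
   [11 * 16^2 = 2816 <= 27 * 125]. *)
have := leq_mul p_le (leq_mul T_ge T_ge); rewrite (expnS p) -!mulnn.
by lia.
Qed.

Lemma pow_expn p n : Nat.pow p n = expn p n.
Proof. by elim: n => //= n ->; rewrite expnS. Qed.

Lemma INR_expn p n : INR (expn p n) = (INR p ^ n)%R.
Proof. by elim: n => //= n IHn; rewrite expnS mult_INR IHn. Qed.

Lemma Rpower_pow_5_4 s n : (0 < s)%R ->
  Rpower (s ^ (4 * n)) (5 / 4) = (s ^ (5 * n))%R.
Proof.
move=> s_gt0; rewrite -!Rpower_pow // Rpower_mult; congr Rpower.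
by rewrite !mult_INR /=; lra.
Qed.

(* [0.19239 ^ 2 < 1 / 27] *)
Lemma sqrt_cube_le (p N : nat) : (expn p 3 <= 27 * expn N 2)%N ->
  (0.19239 * sqrt (INR p) ^ 3 <= INR N)%R.
Proof.
move=> /leP/le_INR; rewrite INR_expn mult_INR INR_expn => cube_le.
set s := sqrt (INR p).
have s6 : (s ^ 3 * s ^ 3 = INR p ^ 3)%R.
  have <- : (s ^ 2 = INR p)%R.
    by rewrite /= Rmult_1_r sqrt_sqrt //; apply: pos_INR.
  by rewrite -pow_mult -pow_add.
have c27 : INR 27 = 27%R by rewrite INR_IZR_INZ.
rewrite c27 /= Rmult_1_r in cube_le.
apply: Rsqr_incr_0_var (pos_INR N); rewrite /Rsqr.
have s3_ge0 : (0 <= s ^ 3)%R by apply/pow_le/sqrt_pos.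
move: (s ^ 3)%R s6 s3_ge0 => s3 /= s6 s3_ge0.
by nra.
Qed.

End Estimates.

Theorem theorem3 :
  exists C : R,
  forall (p m : nat) (F : finFieldType),
    prime p -> odd p -> (0 < m)%N -> #|F| = (p ^ (2 * m))%N ->
    exists I : {set {set 'rV[F]_3}},
      Uq_independent (p ^ m) I /\
      (forall P, P \in I -> ~ Uq_absolute (p ^ m) P) /\
      (0.19239 * Rpower (INR #|F|) (5 / 4) - C * INR #|F| <= INR #|I|)%R.
Proof.
exists 0%R => p m F p_pr p_odd m_gt0; rewrite !pow_expn => card_F.
have p_gt2 := odd_prime_gt2 p_odd p_pr.
(* [q = s ^ (4 m)], so [q ^ (5 / 4)] is the integral power [s ^ (5 m)]. *)
set s := sqrt (INR p).
have p_ge3 : (3 <= INR p)%R.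
  by have := le_INR 3 p (elimT leP p_gt2); rewrite /=; lra.
have s_gt0 : (0 < s)%R by apply: sqrt_lt_R0; lra.
have s2 : (s ^ 2 = INR p)%R by rewrite /= Rmult_1_r sqrt_sqrt //; lra.
have expn_s n : INR (expn p n) = (s ^ (2 * n))%R.
  by rewrite INR_expn -s2 -pow_mult.
have q54 : Rpower (INR #|F|) (5 / 4) = (s ^ (5 * m))%R.
  by rewrite card_F expn_s mulnA Rpower_pow_5_4.
rewrite q54 Rmult_0_l Rminus_0_r.
have [m_odd | m_even] := boolP (odd m).
- have [a a_lt a_le] := exists_interval_length p_odd p_gt2.
  have m_eq : m = (m./2 + m./2).+1 by lia.
  have [I [I_ind I_abs card_I]] :=
    independent_of_leading_coefs p_pr p_odd m_gt0 card_F a_lt (or_introl m_eq).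
  exists I; split=> //; split=> //.
  rewrite card_I mult_INR expn_s.
  (* The free coefficients give [s ^ (5 m - 3)]; the pairs [(i, j)] must supply [0.19239 s ^ 3]. *)
  have -> : (5 * m = 2 * (m./2 + m.-1 + m) + 3)%N by lia.
  rewrite pow_add.
  have := sqrt_cube_le a_le; rewrite -/s.
  have := pow_lt s (2 * (m./2 + m.-1 + m)) s_gt0.
  by nra.
have m_eq : m = (m./2 + m./2)%N by lia.
have p2_gt0 : (expn 0 2 < p./2)%N by lia.
have [I [I_ind I_abs card_I]] := independent_of_leading_coefs p_pr p_odd m_gt0
  card_F p2_gt0 (or_intror (conj m_eq erefl)).
exists I; split=> //; split=> //.
rewrite card_I muln0 mul1n subn0 mult_INR expn_s.
have -> : (5 * m = 2 * (m./2 + m.-1 + m) + 2)%N by lia.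
(* Here the missing factor is only [s ^ 2 = p], and [p./2 >= p / 3] exceeds [0.19239 p]. *)
have half_p : (INR p <= 3 * INR p./2)%R.
  have p_le : (p <= 3 * p./2)%N by lia.
  by have := le_INR _ _ (elimT leP p_le); rewrite mult_INR /=; lra.
rewrite pow_add s2.
have := pow_lt s (2 * (m./2 + m.-1 + m)) s_gt0.
by nra.
Qed.
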